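(* Let $A$ and $B$ be unital $C^*$-algebras and let $\phi : A \to B$ be a unital $*$-preserving ring homomorphism (not assumed to be linear). Then there exist projections $P, Q \in B$ such that $P$ and $Q$ commute with every element of the image of $\phi$, $P + Q = 1_B$, the map $\phi_1 : A \to B$ given by $\phi_1(a) := P\phi(a)$ is a (complex-)linear $*$-preserving ring homomorphism, and the map $\phi_2 : A \to B$ given by $\phi_2(a) := Q\phi(a)$ is a conjugate-linear $*$-preserving ring homomorphism. Thus $\phi = \phi_1 + \phi_2$, and $\phi$ is the direct sum of a linear $*$-preserving ring homomorphism and a conjugate-linear $*$-preserving ring homomorphism. Moreover, if the $C^*$-subalgebra of $B$ generated by the image of $\phi$ has trivial center (i.e., its center is $\{\lambda 1_B : \lambda \in \mathbb{C}\}$), then either $\phi_1 = 0$ or $\phi_2 = 0$, and $\phi$ is either linear or conjugate-linear.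
   Context: All $C^*$-algebras are over $\mathbb{C}$. A ring homomorphism $\phi : A \to B$ between $C^*$-algebras is a function that is additive ($\phi(a+b)=\phi(a)+\phi(b)$ for all $a,b\in A$) and multiplicative ($\phi(ab)=\phi(a)\phi(b)$ for all $a,b \in A$); it is not assumed to be compatible with scalar multiplication, nor to be unital unless stated. It is $*$-preserving if $\phi(a^* )=\phi(a)^*$ for all $a \in A$. When $A$ and $B$ have units $1_A$ and $1_B$, it is unital if $\phi(1_A)=1_B$. A projection in a $C^*$-algebra is an element $P$ with $P=P^*=P^2$. An additive map $\psi$ is conjugate-linear if $\psi(\lambda a)=\overline{\lambda}\psi(a)$ for all $\lambda\in\mathbb{C}$ and $a \in A$. *)

(* Defs.v *)
From HB Require Import structures.
From mathcomp Require Import all_boot all_order all_algebra.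
From mathcomp Require Import all_classical all_reals all_analysis.
From mathcomp Require Import complex.

Set Implicit Arguments.
Unset Strict Implicit.
Unset Printing Implicit Defensive.

Import Order.TTheory GRing.Theory Num.Theory.
Import numFieldNormedType.Exports.

Local Open Scope classical_set_scope.
Local Open Scope ring_scope.

(* Unital C*-algebras over R[i]. The norm of a normed module over R[i] takes its
   values in R[i]: they are nonnegative, and <= on R[i] restricts to the usual
   order on R. The equation 1 = 0 is not excluded: the zero algebra is unital.
   The ring operations are fields of a record because the ring and normed
   module structures have no join from which Num.NumDomain inherits, so that
   HB.structure rejects their combination; ring and normed module instances are
   declared below. *)
Record cstarAlgType (R : realType) := CStarAlgType {
  cstar_carrier : completeNormedModType R[i];
  cstar_one : cstar_carrier;
  cstar_mul : cstar_carrier -> cstar_carrier -> cstar_carrier;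
  cstar_star : cstar_carrier -> cstar_carrier;
  cstar_mulA : associative cstar_mul;
  cstar_mul1l : left_id cstar_one cstar_mul;
  cstar_mul1r : right_id cstar_one cstar_mul;
  cstar_mulDl : left_distributive cstar_mul +%R;
  cstar_mulDr : right_distributive cstar_mul +%R;
  cstar_scaleAl : forall (l : R[i]) a b,
    l *: cstar_mul a b = cstar_mul (l *: a) b;
  cstar_scaleAr : forall (l : R[i]) a b,
    l *: cstar_mul a b = cstar_mul a (l *: b);
  cstar_starK : involutive cstar_star;
  cstar_starD : {morph cstar_star : a b / a + b};
  cstar_starZ : forall (l : R[i]) a,
    cstar_star (l *: a) = conjc l *: cstar_star a;
  cstar_starM : forall a b,
    cstar_star (cstar_mul a b) = cstar_mul (cstar_star b) (cstar_star a);
  cstar_normM : forall a b, `|cstar_mul a b| <= `|a| * `|b|;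
  cstar_identity : forall a, `|cstar_mul (cstar_star a) a| = `|a| ^+ 2
}.

Definition cstar_sort (R : realType) (A : cstarAlgType R) : Type :=
  cstar_carrier A.
Coercion cstar_sort : cstarAlgType >-> Sortclass.

HB.instance Definition _ (R : realType) (A : cstarAlgType R) :=
  CompleteNormedModule.copy (cstar_sort A) (cstar_carrier A).
HB.instance Definition _ (R : realType) (A : cstarAlgType R) :=
  GRing.Zmodule_isPzRing.Build (cstar_sort A) (@cstar_mulA R A)
    (@cstar_mul1l R A) (@cstar_mul1r R A) (@cstar_mulDl R A) (@cstar_mulDr R A).

Section CStarAlgebraTheory.
Variables (R : realType) (A : cstarAlgType R).

Definition star : A -> A := @cstar_star R A.

Lemma scalerAl_cstar (l : R[i]) (a b : A) : l *: (a * b) = (l *: a) * b.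
Proof. exact: cstar_scaleAl. Qed.

Lemma scalerAr_cstar (l : R[i]) (a b : A) : l *: (a * b) = a * (l *: b).
Proof. exact: cstar_scaleAr. Qed.

Lemma starK : involutive star.
Proof. exact: cstar_starK. Qed.

Lemma starD : {morph star : a b / a + b}.
Proof. exact: cstar_starD. Qed.

Lemma starZ (l : R[i]) (a : A) : star (l *: a) = conjc l *: star a.
Proof. exact: cstar_starZ. Qed.

Lemma starM (a b : A) : star (a * b) = star b * star a.
Proof. exact: cstar_starM. Qed.

Lemma normrM_cstar (a b : A) : `|a * b| <= `|a| * `|b|.
Proof. exact: cstar_normM. Qed.

Lemma norm_star_mul (a : A) : `|star a * a| = `|a| ^+ 2.
Proof. exact: cstar_identity. Qed.

End CStarAlgebraTheory.

Section CStarAlgebraNotions.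
Variable R : realType.

Section Maps.
Variables A B : cstarAlgType R.
Implicit Types phi psi : A -> B.

(* Neither unital nor homogeneous for scalars. *)
Definition ring_hom phi :=
  {morph phi : a b / a + b} /\ {morph phi : a b / a * b}.

Definition star_preserving phi := {morph phi : a / star a}.

Definition conj_linear psi :=
  {morph psi : a b / a + b} /\
  forall (l : R[i]) (a : A), psi (l *: a) = conjc l *: psi a.

(* Internal direct sum of maps into B: phi is the pointwise sum, and the two
   ranges annihilate each other on both sides. *)
Definition is_direct_sum phi phi1 phi2 :=
  (forall a, phi a = phi1 a + phi2 a) /\
  (forall a b, phi1 a * phi2 b = 0 /\ phi2 b * phi1 a = 0).

End Maps.

Variable B : cstarAlgType R.

Definition is_projection (p : B) := p = star p /\ p = p ^+ 2.

Definition is_cstar_subalgebra (S : set B) :=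
  [/\ S 0,
      (forall x y, S x -> S y -> S (x + y)),
      (forall (l : R[i]) x, S x -> S (l *: x)),
      (forall x y, S x -> S y -> S (x * y)) &
      (forall x, S x -> S (star x))] /\ closed S.

Definition cstar_generated (G : set B) : set B := smallest is_cstar_subalgebra G.

Definition center (S : set B) : set B :=
  [set z | S z /\ forall x, S x -> z * x = x * z].

Definition trivial_center (S : set B) :=
  center S = [set l *: (1 : B) | l in [set: R[i]]].

End CStarAlgebraNotions.

(* Main.v *)
(** The scalars act through central elements [phi (l *: 1)] of the image. For
    real [t] in [-1, 1], [t] is the real part of a point [z] of the unit circle,
    so [phi (t *: 1)] is the real part of the unitary [phi (z *: 1)] and has
    norm at most 1: an additive map that is bounded on [-1, 1] is real linear,
    hence so is [phi]. Then [J = phi ('i *: 1)] satisfies [J^2 = -1] and [J^* = -J],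
    so that [S = - 'i *: J] is a self-adjoint unitary, central in the algebra
    generated by the image, and [P], [Q] are its spectral projections
    [(1 + S) / 2] and [(1 - S) / 2], on which [J] acts as ['i] and [- 'i]. *)
Require Import Defs.
From HB Require Import structures.
From mathcomp Require Import all_boot all_order all_algebra.
From mathcomp Require Import all_classical all_reals all_analysis.
From mathcomp Require Import complex.

Set Implicit Arguments.
Unset Strict Implicit.
Unset Printing Implicit Defensive.

Import Order.TTheory GRing.Theory Num.Theory.
Import numFieldNormedType.Exports.

Local Open Scope classical_set_scope.
Local Open Scope ring_scope.
Local Open Scope complex_scope.

Lemma star1 (R : realType) (A : cstarAlgType R) : star (1 : A) = 1.
Proof. by have := starM (star (1 : A)) 1; rewrite !(mulr1, starK). Qed.

Lemma star0 (R : realType) (A : cstarAlgType R) : star (0 : A) = 0.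
Proof. by apply: (addIr (star 0)); rewrite -starD !add0r. Qed.

Lemma starN (R : realType) (A : cstarAlgType R) (a : A) : star (- a) = - star a.
Proof. by apply: (addIr (star a)); rewrite -starD !addNr star0. Qed.

(** The C*-identity gives [|u|^2 = |1|], and applied to [1] it gives [|1| = |1|^2], so [|1|] is 0 or
    1. The value 0 occurs in the zero algebra, hence an inequality. *)
Lemma star_isometry_norm_le1 (R : realType) (A : cstarAlgType R) (u : A) :
  star u * u = 1 -> `|u| <= 1.
Proof.
have norm1 : `|1 : A| <= 1.
  have := norm_star_mul (1 : A); rewrite star1 mulr1.
  have [->|n0] := eqVneq `|1 : A| 0; first by rewrite ler01.
  by rewrite expr2 -[LHS]mulr1 => /(mulfI n0) <-.
move=> uu; rewrite -(@expr_le1 _ 2) //.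
by rewrite -norm_star_mul uu.
Qed.

(** Since [g] vanishes on the integers, it is 1-periodic, so the bound on [[-1, 1]] holds
    everywhere. Then [n |g t| = |g (n t)| <= M] for all [n], and the Archimedean property forces
    [g t = 0]. *)
Lemma additive_bounded_eq0 (R : realType) (V : normedModType R[i]) (g : R -> V)
    (M : R[i]) :
  {morph g : s t / s + t} -> g 1 = 0 ->
  (forall t, `|t| <= 1 -> `|g t| <= M) -> forall t, g t = 0.
Proof.
move=> gD g1 gM t.
have g0 : g 0 = 0 by apply: (addIr (g 0)); rewrite -gD !add0r.
have gN s : g (- s) = - g s by apply: (addIr (g s)); rewrite -gD !addNr.
have gMn s n : g (s *+ n) = g s *+ n.
  by elim: n => [|n IH]; rewrite ?mulr0n // !mulrS gD IH.
have gz (m : int) : g m%:~R = 0.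
  case: m => n; rewrite ?NegzE ?rmorphN /= ?gN /= -pmulrn gMn g1 mul0rn //.
  exact: oppr0.
have gM' s : `|g s| <= M.
  have -> : g s = g (s - (Num.floor s)%:~R) by rewrite gD gN gz subr0.
  apply: gM; have /andP[h1 h2] := floor_itv s.
  by rewrite ger0_norm ?subr_ge0 // lerBlDl -intrD1 ltW.
apply/eqP; rewrite -normr_eq0; apply/eqP.
(* Norms live in [R[i]]. Both sides of the bound are real, [M] because it dominates a norm, so the
   Archimedean argument can take place in [R]. *)
have /complex_realP[r rE] : `|g t| \is Num.real by rewrite normr_real.
have /complex_realP[b bE] : M \is Num.real.
  by rewrite ger0_real // (le_trans _ (gM' 0)).
have r0 : 0 <= r by rewrite -ler0c -rE.
have rn n : r *+ n <= b.
  by rewrite -lecR rmorphMn /= -rE -bE -normrMn -gMn gM'.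
rewrite rE; suff -> : r = 0 by [].
apply/eqP; rewrite eq_le r0 andbT leNgt; apply/negP => rp.
have b0 : 0 <= b by have := rn 0%N; rewrite mulr0n.
have := archi_boundP (divr_ge0 b0 r0); set n := Num.Def.archi_bound _.
by rewrite ltr_pdivrMr // mulr_natl ltNge rn.
Qed.

Section RingHom.
Variables (R : realType) (A B : cstarAlgType R) (phi : A -> B).
Hypothesis phi_hom : ring_hom phi.
Hypothesis phi_star : star_preserving phi.
Hypothesis phi_unital : phi 1 = 1.

Let phiD : {morph phi : a b / a + b}. Proof. exact: phi_hom.1. Qed.
Let phiM : {morph phi : a b / a * b}. Proof. exact: phi_hom.2. Qed.

Lemma ring_hom0 : phi 0 = 0.
Proof. by apply: (addIr (phi 0)); rewrite -phiD !add0r. Qed.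

Lemma ring_homN a : phi (- a) = - phi a.
Proof. by apply: (addIr (phi a)); rewrite -phiD !addNr ring_hom0. Qed.

Lemma ring_hom_scalarM l a : phi (l *: (1 : A)) * phi a = phi (l *: a).
Proof. by rewrite -phiM -scalerAl_cstar mul1r. Qed.

Lemma ring_hom_scalarC l a :
  phi (l *: (1 : A)) * phi a = phi a * phi (l *: (1 : A)).
Proof. by rewrite ring_hom_scalarM -phiM -scalerAr_cstar mulr1. Qed.

Lemma star_ring_hom_scalar l :
  star (phi (l *: (1 : A))) = phi (conjc l *: (1 : A)).
Proof. by rewrite -phi_star starZ star1. Qed.

Lemma norm_ring_hom_real_le1 (t : R) :
  `|t| <= 1 -> `|phi (t%:C *: (1 : A))| <= 1.
Proof.
move=> t1; have t2 : 0 <= 1 - t ^+ 2.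
  by rewrite subr_ge0 -[t ^+ 2]real_normK ?num_real // exprn_ile1.
pose z := Complex t (Num.sqrt (1 - t ^+ 2)).
have zz : conjc z * z = 1.
  by rewrite mulrC -sqr_normc -add_Re2_Im2 /= sqr_sqrtr // addrC subrK.
pose u := phi (z *: (1 : A)).
have u1 : `|u| <= 1.
  apply: star_isometry_norm_le1.
  by rewrite star_ring_hom_scalar ring_hom_scalarM scalerA zz scale1r.
(* Images of scalars commute, so [u] is also a co-isometry. *)
have u'1 : `|star u| <= 1.
  apply: star_isometry_norm_le1.
  rewrite starK star_ring_hom_scalar -ring_hom_scalarC.
  by rewrite ring_hom_scalarM scalerA zz scale1r.
have h : phi (t%:C *: (1 : A)) *+ 2 = u + star u.
  rewrite star_ring_hom_scalar -phiD -scalerDl addcJ /= mulr_natl.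
  by rewrite -scalerMnl mulr2n -phiD mulr2n.
rewrite -(@ler_pMn2r _ 2) // -normrMn h.
by apply: le_trans (ler_normD _ _) _; rewrite mulr2n lerD.
Qed.

Lemma ring_hom_realZ (t : R) a :
  phi (t%:C *: a) = t%:C *: phi a.
Proof.
suff h : phi (t%:C *: (1 : A)) = t%:C *: (1 : B).
  by rewrite -ring_hom_scalarM h -scalerAl_cstar mul1r.
apply/eqP; rewrite -subr_eq0; apply/eqP.
(* This defect is additive, vanishes at 1 because [phi] is unital, and is bounded by [1 + |1|] on
   [[-1, 1]]. *)
pose g (s : R) : B :=
  phi (s%:C *: (1 : A)) - s%:C *: (1 : B).
apply: (@additive_bounded_eq0 _ _ g (1 + `|1 : B|)) => [x y||s s1].
- by rewrite /g rmorphD /= !scalerDl phiD opprD addrACA.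
- by rewrite /g rmorph1 !scale1r phi_unital subrr.
apply: le_trans (ler_normB _ _) _; apply: lerD (norm_ring_hom_real_le1 s1) _.
rewrite normrZ ler_piMl //.
by rewrite normc_def /= expr0n /= addr0 sqrtr_sqr lecR.
Qed.

(** Multiplication by ['i] in [A] becomes multiplication by [J = 'i *: S] in [B]; real scalars pass
    through [phi] unchanged. Membership of [S] in the generated algebra serves the statement about
    the center. *)
Lemma ring_hom_scaleE : exists S : B,
  [/\ S * S = 1, star S = S, cstar_generated (range phi) S,
      forall a, S * phi a = phi a * S &
      forall (s t : R) a,
        phi ((s +i* t) *: a) = s%:C *: phi a + ('i%C * t%:C) *: (S * phi a)].
Proof.
pose J := phi ('i%C *: (1 : A)); exists (- 'i%C *: J).
have ii : 'i%C * 'i%C = -1 :> R[i] by rewrite -expr2 sqr_i.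
have JJ : J * J = -1.
  by rewrite ring_hom_scalarM scalerA ii scaleN1r ring_homN phi_unital.
split.
- rewrite -scalerAl_cstar -scalerAr_cstar JJ scalerA mulrNN ii scalerN scaleN1r.
  by rewrite opprK.
- rewrite starZ star_ring_hom_scalar.
  have -> : conjc 'i%C = - 'i%C :> R[i].
    by apply/eqP; rewrite eq_complex /= oppr0 !eqxx.
  have -> : conjc (- 'i%C) = 'i%C :> R[i].
    by apply/eqP; rewrite eq_complex /= oppr0 opprK !eqxx.
  by rewrite scaleNr ring_homN scalerN scaleNr.
- move=> X [[[X0 XD XZ XM Xs] Xcl] Xphi]; apply: XZ; apply: Xphi.
  by exists ('i%C *: (1 : A)).
- by move=> a; rewrite -scalerAl_cstar -scalerAr_cstar ring_hom_scalarC.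
move=> s t a; rewrite [_ +i* _]complexE scalerDl phiD ring_hom_realZ.
congr (_ + _).
rewrite [_ * _]mulrC -!scalerA ring_hom_realZ -ring_hom_scalarM -scalerAl_cstar.
by congr (_ *: _); rewrite scalerA mulrN ii opprK scale1r.
Qed.

End RingHom.

(** If [y] commutes with [p], the commutator of [p] with [x] equals that with [x - y], so its norm
    is at most [2 |p| |x - y|]. *)
Lemma closed_commutant (R : realType) (B : cstarAlgType R) (p : B) :
  closed [set x : B | p * x = x * p].
Proof.
move=> x clx /=; apply: contrapT => /eqP; rewrite -subr_eq0 -normr_gt0 => d0.
set d := `|_| in d0.
(* The added 1 keeps the denominator positive when [p = 0] and makes [d <= 2 |p| e < d] a strict
   contradiction. *)
pose e := d / (`|p| *+ 2 + 1).
have den0 : 0 < `|p| *+ 2 + 1 by rewrite ltr_wpDl // mulrn_wge0.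
have e0 : 0 < e by rewrite divr_gt0.
have [y [/= py]] := clx _ (nbhsx_ballx x e e0).
rewrite -ball_normE /= => xy.
have dE : d <= `|p| * e *+ 2.
  have -> : d = `|p * (x - y) - (x - y) * p|.
    by rewrite mulrBr mulrBl py opprB addrA subrK.
  apply: le_trans (ler_normB _ _) _; rewrite mulr2n; apply: lerD.
    by apply: le_trans (normrM_cstar _ _) _; rewrite ler_wpM2l // ltW.
  apply: le_trans (normrM_cstar _ _) _; rewrite mulrC ler_wpM2l // ltW //.
have : d < e * (`|p| *+ 2 + 1).
  by rewrite mulrDr mulr1 mulrC mulrnAl ltr_pwDr.
by rewrite /e divfK ?ltxx // gt_eqF.
Qed.

(** The commutant of [p] is itself a C*-subalgebra containing [G]; self-adjointness of [p] makes it
    stable under [star]. *)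
Lemma cstar_generated_commutant (R : realType) (B : cstarAlgType R) (G : set B)
    (p x : B) :
  star p = p -> (forall y, G y -> p * y = y * p) ->
  cstar_generated G x -> p * x = x * p.
Proof.
move=> ps Gp /(_ [set z | p * z = z * p]); apply; split=> //.
split; last exact: closed_commutant.
split=> [|y z /= py pz|l y /= py|y z /= py pz|y /= py].
- by rewrite /= mulr0 mul0r.
- by rewrite mulrDr mulrDl py pz.
- by rewrite -scalerAl_cstar -scalerAr_cstar py.
- by rewrite mulrA py -mulrA pz mulrA.
- by rewrite -ps -!starM py.
Qed.

Theorem proposition3p9 (R : realType) (A B : cstarAlgType R) (phi : A -> B)
    (phi_hom : ring_hom phi) (phi_star : star_preserving phi)
    (phi_unital : phi 1 = 1) :
  exists P Q : B,
    let phi1 := fun a : A => P * phi a in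
    let phi2 := fun a : A => Q * phi a in
    [/\ is_projection P, is_projection Q,
        (forall a : A, P * phi a = phi a * P),
        (forall a : A, Q * phi a = phi a * Q) &
        P + Q = 1] /\
    [/\ linear phi1, ring_hom phi1 & star_preserving phi1] /\
    [/\ conj_linear phi2, ring_hom phi2 & star_preserving phi2] /\
    is_direct_sum phi phi1 phi2 /\
    (trivial_center (cstar_generated (range phi)) ->
      ((forall a : A, phi1 a = 0) \/ (forall a : A, phi2 a = 0)) /\
      (linear phi \/ conj_linear phi)).
Proof.
have [S [SS Ss genS Sphi phiZ]] := ring_hom_scaleE phi_hom phi_star phi_unital.
have [phiD phiM] := phi_hom.
pose P : B := 2^-1 *: (1 + S); pose Q : B := 2^-1 *: (1 - S).
have half (x : B) : 2^-1 *: (x + x) = x.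
  rewrite -[x in x + _]scale1r -[x in _ + x]scale1r -scalerDl scalerA.
  by rewrite mulVf ?scale1r // pnatr_eq0.
(* [S] acts as 1 on [P] and as -1 on [Q]. Idempotence, orthogonality and both scalar laws follow
   from these two identities. *)
have PS : P * S = P by rewrite -scalerAl_cstar mulrDl mul1r SS addrC.
have QS : Q * S = - Q.
  by rewrite -scalerAl_cstar mulrBl mul1r SS -opprB scalerN.
have PQ1 : P + Q = 1 by rewrite -scalerDr addrACA subrr addr0 half.
have PP : P * P = P by rewrite {2}/P -scalerAr_cstar mulrDr mulr1 PS half.
have QQ : Q * Q = Q by rewrite {2}/Q -scalerAr_cstar mulrBr mulr1 QS opprK half.
have PQ : P * Q = 0 by rewrite -scalerAr_cstar mulrBr mulr1 PS subrr scaler0.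
have QP : Q * P = 0 by rewrite -scalerAr_cstar mulrDr mulr1 QS subrr scaler0.
have half_conj : conjc 2^-1 = 2^-1 :> R[i] by rewrite conjc_inv conjc_nat.
have sP : star P = P by rewrite starZ starD star1 Ss half_conj.
have sQ : star Q = Q by rewrite starZ starD starN star1 Ss half_conj.
have Pphi a : P * phi a = phi a * P.
  by rewrite -scalerAl_cstar -scalerAr_cstar mulrDl mulrDr mul1r mulr1 Sphi.
have Qphi a : Q * phi a = phi a * Q.
  by rewrite -scalerAl_cstar -scalerAr_cstar mulrBl mulrBr mul1r mulr1 Sphi.
have PZ (l : R[i]) a : P * phi (l *: a) = l *: (P * phi a).
  case: l => s t; rewrite phiZ mulrDr -!scalerAr_cstar mulrA PS -scalerDl.
  by congr (_ *: _); rewrite [RHS]complexE.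
have QZ (l : R[i]) a : Q * phi (l *: a) = conjc l *: (Q * phi a).
  case: l => s t; rewrite phiZ mulrDr -!scalerAr_cstar mulrA QS mulNr scalerN.
  rewrite -scaleNr -scalerDl; congr (_ *: _).
  by rewrite [RHS]complexE /= rmorphN mulrN.
(* Cutting by a projection that commutes with the image preserves products and [star]; this serves
   [P] and [Q] alike. *)
have homP (p : B) : p * p = p -> star p = p ->
    (forall a, p * phi a = phi a * p) ->
    ring_hom (fun a => p * phi a) /\ star_preserving (fun a => p * phi a).
  move=> pp ps pphi; split; [split=> a b|move=> a].
  - by rewrite phiD mulrDr.
  - by rewrite phiM -[RHS]mulrA [phi a * (p * _)]mulrA -pphi !mulrA pp.
  - by rewrite phi_star pphi starM ps.
have [homP1 starP1] := homP P PP sP Pphi.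
have [homQ1 starQ1] := homP Q QQ sQ Qphi.
have phiPQ a : phi a = P * phi a + Q * phi a by rewrite -mulrDl PQ1 mul1r.
have linP : linear (fun a => P * phi a) by move=> l a b; rewrite homP1.1 PZ.
have clinQ : conj_linear (fun a => Q * phi a) by split; [exact: homQ1.1|].
exists P, Q; split; first by split=> //; split; rewrite ?expr2.
split; first by split.
split; first by split.
split.
  split=> // a b; split.
    by rewrite Pphi -mulrA [P * _]mulrA PQ mul0r mulr0.
  by rewrite Qphi -mulrA [Q * _]mulrA QP mul0r mulr0.
move=> trivC.
(* [P] is a combination of [1 = phi 1] and [S], both in the generated algebra, and it commutes with
   the generators. *)
have : Defs.center (cstar_generated (range phi)) P.
  split=> [X XA|x genx]; last first.
    by apply: (cstar_generated_commutant sP _ genx) => _ [a _ <-].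
  have [[[_ XD XZ _ _] _] Xphi] := XA; apply/XZ/XD; last exact: genS.
  by apply: Xphi; exists 1.
rewrite trivC => -[l _ Pl].
(* With [P = l *: 1], orthogonality reads [l *: Q = P * Q = 0], so [l = 0] or [Q = 0]. *)
have [P0|Q0] : P = 0 \/ Q = 0.
  have [l0|l0] := eqVneq l 0; first by left; rewrite -Pl l0 scale0r.
  right; have : l *: Q = 0 by rewrite -PQ -Pl -scalerAl_cstar mul1r.
  move/(congr1 (fun x => l^-1 *: x)).
  by rewrite scalerA mulVf // scale1r scaler0.
- have phi2E : phi = fun a => Q * phi a.
    by apply/funext => a; rewrite [LHS]phiPQ P0 mul0r add0r.
  split; first by left=> a; rewrite P0 mul0r.
  by right; rewrite phi2E.
- have phi1E : phi = fun a => P * phi a.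
    by apply/funext => a; rewrite [LHS]phiPQ Q0 mul0r addr0.
  split; first by right=> a; rewrite Q0 mul0r.
  by left; rewrite phi1E.
Qed.
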